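(* Let $v$ be a valuation on $\overline{K}(X)$ and suppose that the extension $(K(X)|K,v)$ is valuation algebraic. Let $\lambda$ be a limit ordinal and let $\{\gamma_\nu\}_{\nu<\lambda}\subseteq v(X-\overline{K}):=\{v(X-a)\mid a\in\overline{K}\}$ and $\{a_\nu\}_{\nu<\lambda}\subseteq\overline{K}$ be sequences such that (i) $\gamma_\nu<\gamma_\mu$ for all $\nu<\mu<\lambda$, and $\{\gamma_\nu\}_{\nu<\lambda}$ is cofinal in $v(X-\overline{K})$; and for all $\nu<\lambda$: (ii) $v(X-a_\nu)=\gamma_\nu$; (iii) $(a_\nu,\gamma_\nu)$ is a minimal pair of definition for $v_{a_\nu,\gamma_\nu}$ over $K$; (iv) $v(X-a_\nu)\geq v(X-\sigma a_\nu)$ for all $K$-conjugates $\sigma a_\nu$ of $a_\nu$. For each $\nu<\lambda$, let $Q_\nu(X)\in K[X]$ be the minimal polynomial of $a_\nu$ over $K$. Then $\{Q_\nu\}_{\nu<\lambda}$ forms a complete sequence of key polynomials for $v$ over $K$.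
   Context: Valuations are Krull valuations written additively (arbitrary ordered abelian value groups, arbitrary rank). $K$ is a field, $\overline{K}$ a fixed algebraic closure of $K$, $X$ an indeterminate, and $v$ a valuation on $\overline{K}(X)$; its restrictions to subfields are also denoted $v$. For a subfield $F$, $vF$ is the value group and $Fv$ the residue field. The extension $(K(X)|K,v)$ always satisfies $\dim_{\mathbb{Q}}\left(\mathbb{Q}\otimes_{\mathbb{Z}}(vK(X)/vK)\right)+\mathrm{trdeg}[K(X)v:Kv]\leq 1$. It is called valuation algebraic if this inequality is strict (i.e. $vK(X)/vK$ is torsion and $K(X)v|Kv$ is algebraic). (For valuation algebraic extensions, sequences with properties (i)-(iv) exist.) For $a\in\overline{K}$ and $\gamma$ in an ordered abelian group containing $v\overline{K}$, $v_{a,\gamma}$ is the valuation on $\overline{K}(X)$ extending $v|_{\overline{K}}$ given on polynomials by $v_{a,\gamma}\left(\sum_{i=0}^n c_i(X-a)^i\right)=\min_i\{vc_i+i\gamma\}$, $c_i\in\overline{K}$. A pair of definition over $K$ for a valuation $w$ on $\overline{K}(X)$ extending $v|_{\overline{K}}$ is a pair $(a,\gamma)\in\overline{K}\times w\overline{K}(X)$ with $w=v_{a,\gamma}$. It is a minimal pair of definition for $w$ over $K$ if moreover, for all $a'\in\overline{K}$, $v(a-a')\geq\gamma$ implies $[K(a'):K]\geq[K(a):K]$. For a nonzero $f\in K[X]$ put $\delta(f):=\max\{v(X-a)\mid a\in\overline{K},\ f(a)=0\}$, with $\delta(f)=-\infty$ if $f$ is a nonzero constant. A nonconstant monic polynomial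 $Q\in K[X]$ is a key polynomial for $v$ over $K$ if for every nonzero $f\in K[X]$, $\deg f<\deg Q$ implies $\delta(f)<\delta(Q)$. For a nonconstant monic $Q\in K[X]$, each $f\in K[X]$ has a unique expansion $f=f_0+f_1Q+\dots+f_rQ^r$ with $f_i\in K[X]$, $\deg f_i<\deg Q$; set $v_Qf:=\min_i\{vf_i+i\,vQ\}$. A family $\Lambda$ of key polynomials for $v$ over $K$ is a complete sequence of key polynomials for $v$ over $K$ if: (1) $\delta(Q)\neq\delta(Q')$ for $Q,Q'\in\Lambda$ with $Q\neq Q'$; (2) $\Lambda$ is well-ordered by $Q<Q'$ if and only if $\delta(Q)<\delta(Q')$; (3) for every $f\in K[X]$ there is some $Q\in\Lambda$ with $vf=v_Qf$. *)

(* Defs.v *)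
From HB Require Import structures.
From mathcomp Require Import all_boot all_order all_algebra.

Set Implicit Arguments.
Unset Strict Implicit.
Unset Printing Implicit Defensive.

Import Order.TTheory GRing.Theory.

Local Open Scope ring_scope.
Local Open Scope quotient_scope.

Record oagType := OagType {
  oag_base : porderZmodType;
  oag_total : total (<=%R : rel oag_base);
  oag_lerD : forall x y z : oag_base, x <= y -> z + x <= z + y
}.

(* A plain record rather than a structure of the hierarchy: no structure below
   realDomainType joins a total order with an addition. The instances are
   therefore attached to the constant oag_sort. *)
Definition oag_sort (G : oagType) : Type := oag_base G.
Coercion oag_sort : oagType >-> Sortclass.

HB.instance Definition _ (G : oagType) :=
  Num.POrderedZmodule.copy (oag_sort G) (oag_base G).
HB.instance Definition _ (G : oagType) :=
  Order.POrder_isTotal.Build ring_display (oag_sort G) (@oag_total G).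

Lemma oag_lerD2l (G : oagType) (z x y : G) : x <= y -> z + x <= z + y.
Proof. exact: oag_lerD. Qed.

(* G with both +oo (the value of 0) and -oo (the value of delta on constants)
   adjoined. As in the extended reals, -oo absorbs: the sum -oo + +oo is never
   used, and this choice keeps addition associative. *)
Variant ext (G : Type) := NInf | Fin of G | PInf.
Arguments NInf {G}.
Arguments Fin {G}.
Arguments PInf {G}.

Section Ext.
Variable G : oagType.

Definition ext_code (x : ext G) : G + bool :=
  match x with NInf => inr false | Fin g => inl g | PInf => inr true end.
Definition ext_decode (c : G + bool) : ext G :=
  match c with inl g => Fin g | inr b => if b then PInf else NInf end.

Lemma ext_codeK : cancel ext_code ext_decode. Proof. by case. Qed.

HB.instance Definition _ := Choice.copy (ext G) (can_type ext_codeK).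

Definition ext_le (x y : ext G) : bool :=
  match x, y with
  | NInf, _ | _, PInf => true
  | Fin g, Fin h => g <= h
  | _, _ => false
  end.

Lemma ext_le_refl : reflexive ext_le. Proof. by case=> //= g; exact: lexx. Qed.
Lemma ext_le_anti : antisymmetric ext_le.
Proof. by move=> [|g|] [|h|] //= /le_anti ->. Qed.
Lemma ext_le_trans : transitive ext_le.
Proof. by move=> [|g|] [|h|] [|k|] //=; exact: le_trans. Qed.
Lemma ext_le_total : total ext_le.
Proof. by move=> [|g|] [|h|] //=; exact: le_total. Qed.

HB.instance Definition _ := Order.Le_isPOrder.Build ring_display (ext G)
  ext_le_refl ext_le_anti ext_le_trans.
HB.instance Definition _ := Order.POrder_isTotal.Build ring_display (ext G)
  ext_le_total.

Lemma ext_le0x (x : ext G) : (NInf : ext G) <= x. Proof. by []. Qed.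
Lemma ext_lex1 (x : ext G) : x <= (PInf : ext G). Proof. by case: x. Qed.

HB.instance Definition _ := Order.hasBottom.Build ring_display (ext G) ext_le0x.
HB.instance Definition _ := Order.hasTop.Build ring_display (ext G) ext_lex1.

Definition ext_add (x y : ext G) : ext G :=
  match x, y with
  | NInf, _ | _, NInf => NInf
  | PInf, _ | _, PInf => PInf
  | Fin g, Fin h => Fin (g + h)
  end.

Lemma ext_addA : associative ext_add.
Proof. by move=> [|g|] [|h|] [|k|] //=; rewrite addrA. Qed.
Lemma ext_addC : commutative ext_add.
Proof. by move=> [|g|] [|h|] //=; rewrite addrC. Qed.
Lemma ext_add0 : left_id (Fin 0) ext_add.
Proof. by move=> [|g|] //=; rewrite add0r. Qed.

HB.instance Definition _ :=
  GRing.isNmodule.Build (ext G) ext_addA ext_addC ext_add0.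

Definition ext_opp (x : ext G) : ext G :=
  match x with NInf => PInf | Fin g => Fin (- g) | PInf => NInf end.

Lemma ext_le_Fin (g h : G) : (Fin g <= Fin h :> ext G) = (g <= h).
Proof. by []. Qed.

Lemma ext_lt_Fin (g h : G) : (Fin g < Fin h :> ext G) = (g < h).
Proof. by rewrite !ltNge. Qed.

End Ext.

(* The value group is v(F^* ), possibly a proper subgroup of G. *)
Record valuation (F : fieldType) (G : oagType) := Valuation {
  vfun :> F -> ext G;
  val_zero : vfun 0 = PInf;
  val_fin : forall x, x != 0 -> exists g, vfun x = Fin g;
  val_mul : forall x y, vfun (x * y) = vfun x + vfun y;
  val_add : forall x y, Order.min (vfun x) (vfun y) <= vfun (x + y)
}.

Section ResidueField.
Variables (F : fieldType) (G : oagType) (v : valuation F G).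


Lemma val1 : v 1 = Fin 0.
Proof.
have [g vg] := val_fin v (oner_neq0 F).
have: v 1 + v 1 = v 1 by rewrite -val_mul mulr1.
by rewrite vg => -[/(canRL (addrK g))]; rewrite subrr => ->.
Qed.

Lemma valN x : v (- x) = v x.
Proof.
have vN1 : v (-1) = Fin 0.
  have /(val_fin v) [g vg] : (-1 : F) != 0 by rewrite oppr_eq0 oner_neq0.
  have: v (-1) + v (-1) = Fin 0 by rewrite -val_mul mulrNN mulr1 val1.
  rewrite vg => -[gg0]; congr Fin; apply/le_anti.
  case/orP: (le_total g 0) => g0; rewrite g0 ?andbT /=;
    by have := oag_lerD2l g g0; rewrite addr0 gg0.
by rewrite -mulN1r val_mul vN1 [LHS]add0r.
Qed.

Lemma valV x : x != 0 -> v x + v x^-1 = Fin 0.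
Proof. by move=> x0; rewrite -val_mul mulfV ?val1. Qed.

Lemma ext_addr_ge0 (x y : ext G) : Fin 0 <= x -> Fin 0 <= y -> Fin 0 <= x + y.
Proof.
move: x y => [|g|] [|h|] //= g0 h0.
by apply: le_trans g0 _; have := oag_lerD2l (g : G) h0; rewrite addr0.
Qed.

Lemma ext_addr_gt0 (x y : ext G) : Fin 0 <= x -> Fin 0 < y -> Fin 0 < x + y.
Proof.
move: x y => [|g|] [|h|] //=; rewrite !ext_lt_Fin ext_le_Fin => g0 h0.
have [gh _] := (oag_lerD2l g (ltW h0), tt); rewrite addr0 in gh.
rewrite lt_def (le_trans g0 gh) andbT; apply/eqP => gh0.
have g_0 : g = 0 by apply/le_anti; rewrite g0 -gh0 gh.
by move: h0; rewrite -gh0 g_0 add0r ltxx.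
Qed.

Definition val_ring : {pred F} := fun x => Fin 0 <= v x.

Lemma val_ring_closed : subring_closed val_ring.
Proof.
split=> [|x y x0 y0|x y x0 y0]; rewrite /val_ring !unfold_in.
- by rewrite val1.
- by apply: le_trans (val_add v x (- y)); rewrite valN le_min; apply/andP.
- by rewrite val_mul; apply: ext_addr_ge0.
Qed.

HB.instance Definition _ := GRing.isSubringClosed.Build F val_ring val_ring_closed.

Record vring := VRing { vring_val : F; vring_valP : vring_val \in val_ring }.

HB.instance Definition _ := [isSub for vring_val].
HB.instance Definition _ := [Choice of vring by <:].
HB.instance Definition _ := [SubChoice_isSubComNzRing of vring by <:].

Definition max_ideal : {pred vring} := fun x => Fin 0 < v (val x).

Lemma max_ideal_closed : idealr_closed max_ideal.
Proof.
split=> [||a x y x0 y0]; rewrite /max_ideal !unfold_in.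
- by rewrite /= val_zero.
- by rewrite /= val1 ltxx.
- apply: lt_le_trans (val_add v _ _); rewrite lt_min; apply/andP; split=> //.
  by rewrite /= val_mul; apply: ext_addr_gt0 => //; exact: (vring_valP a).
Qed.

HB.instance Definition _ := isIdealr.Build vring max_ideal max_ideal_closed.

Definition residue_field := {ideal_quot max_ideal}.
HB.instance Definition _ := GRing.ComNzRing.on residue_field.

Definition residue (x : vring) : residue_field := \pi_residue_field x.

Lemma residue_eq0 (x : vring) : (residue x == 0) = (Fin 0 < v (val x)).
Proof.
rewrite /residue -(rmorph0 (\pi_residue_field)) -Quotient.idealrBE subr0.
by rewrite unfold_in.
Qed.

Definition residue_inv (u : residue_field) : residue_field :=
  residue (insubd (0 : vring) (val (repr u))^-1).

Lemma residue_mulVf (u : residue_field) : u != 0 -> residue_inv u * u = 1.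
Proof.
rewrite /residue_inv -{1 3}[u]reprK; set x := repr u => /=.
rewrite -[\pi x]/(residue x) residue_eq0 -leNgt => x_le0.
have vx : v (val x) = Fin 0 by apply/le_anti; rewrite x_le0; exact: (vring_valP x).
have x0 : val x != 0 by apply/eqP => xE; move: vx; rewrite xE val_zero.
have xV : (val x)^-1 \in val_ring.
  have := valV x0; rewrite vx [LHS]add0r => vV.
  by rewrite unfold_in /val_ring vV.
rewrite /residue -(rmorphM (\pi_residue_field)) -(rmorph1 (\pi_residue_field)).
congr (\pi _); apply: val_inj; rewrite rmorphM rmorph1 /=.
by rewrite [vring_val (insubd _ _)]insubdK ?mulVf.
Qed.

Lemma residue_inv0 : residue_inv 0 = 0.
Proof.
apply/eqP; rewrite /residue_inv residue_eq0; set x := repr 0.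
have [xV|xV] := boolP ((val x)^-1 \in val_ring); last first.
  by rewrite val_insubd (negPf xV) rmorph0 val_zero.
rewrite insubdK //; have [-> |x0] := eqVneq (val x) 0.
  by rewrite invr0 val_zero.
have vx_gt0 : Fin 0 < v (val x) by rewrite -residue_eq0 /residue reprK.
have := ext_addr_gt0 xV vx_gt0; rewrite -val_mul mulVf // val1.
by rewrite ltxx.
Qed.

HB.instance Definition _ :=
  GRing.ComNzRing_isField.Build residue_field residue_mulVf residue_inv0.

End ResidueField.

Section WellOrder.
Variables (T : Type) (A : T -> Prop) (R : T -> T -> Prop).

Definition well_ordered : Prop :=
  [/\ forall x, A x -> ~ R x x,
      forall x y z, A x -> A y -> A z -> R x y -> R y z -> R x z,
      forall x y, A x -> A y -> [\/ R x y, x = y | R y x]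
    & forall S : T -> Prop, (forall x, S x -> A x) -> (exists x, S x) ->
        exists2 m, S m & forall x, S x -> x <> m -> R m x].

End WellOrder.

(* The order type of I is a limit ordinal, so that families indexed by I are
   the families indexed by the ordinals below it. *)
Definition limit_ordinal (d : Order.disp_t) (I : orderType d) : Prop :=
  [/\ well_ordered (fun _ : I => True) (fun i j => (i < j)%O),
      inhabited I
    & forall i : I, exists j : I, (i < j)%O].

Section Degree.
Variables (K : fieldType) (L : closedFieldType) (iota : {rmorphism K -> L}).

Definition minimal_poly (a : L) (Q : {poly K}) : Prop :=
  [/\ Q \is monic, root (map_poly iota Q) a
    & forall p : {poly K}, p != 0 -> root (map_poly iota p) a ->
        (size Q <= size p)%N].

Definition simple_ext (a : L) (x : L) : Prop :=
  exists p q : {poly K}, (map_poly iota q).[a] != 0 /\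
    x = (map_poly iota p).[a] / (map_poly iota q).[a].

Definition has_dim (E : L -> Prop) (n : nat) : Prop :=
  exists b : 'I_n -> L,
    [/\ forall i, E (b i),
        forall c : 'I_n -> K, \sum_i iota (c i) * b i = 0 -> forall i, c i = 0
      & forall x, E x -> exists c : 'I_n -> K, x = \sum_i iota (c i) * b i].

(* [K(a) : K] <= [K(a') : K] *)
Definition degree_le (a a' : L) : Prop :=
  forall m n, has_dim (simple_ext a) m -> has_dim (simple_ext a') n ->
    (m <= n)%N.

Definition conjugate (a b : L) : Prop :=
  exists s : {rmorphism L -> L},
    [/\ bijective s, forall c, s (iota c) = iota c & b = s a].

End Degree.

Notation ratfun L := {fraction {poly L}}.

Section KeyPolynomials.
Variables (K : fieldType) (L : closedFieldType) (iota : {rmorphism K -> L}).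
Variables (G : oagType) (v : valuation (ratfun L) G).

Definition constF (c : L) : ratfun L := FracField.tofrac c%:P.

Definition lin (a : L) : ratfun L := FracField.tofrac ('X - a%:P).

Definition polyK (f : {poly K}) : ratfun L :=
  FracField.tofrac (map_poly iota f).

Definition subK (x : ratfun L) : Prop := exists c : K, x = constF (iota c).

Definition subKX (x : ratfun L) : Prop :=
  exists p q : {poly K}, q != 0 /\ x = polyK p / polyK q.

Definition value_group (w : ratfun L -> ext G) (F : ratfun L -> Prop) (g : G) :
  Prop := exists2 x, F x & w x = Fin g.

(* The residue field Fv of a subfield F, inside that of the whole field. *)
Definition subresidue (F : ratfun L -> Prop) (u : residue_field v) : Prop :=
  exists2 x : vring v, F (val x) & u = residue x.

Definition valuation_algebraic : Prop :=
  (forall g, value_group v subKX g ->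
     exists2 n, (0 < n)%N & value_group v subK (g *+ n)) /\
  (forall u, subresidue subKX u ->
     exists2 p : {poly residue_field v}, p != 0 &
       (forall i, subresidue subK p`_i) /\ root p u).

(* The coefficients of p \Po ('X + a%:P) are those of p in powers of X - a. *)
Definition monomial_poly_val (a : L) (gamma : G) (p : {poly L}) : ext G :=
  \big[Order.min/Order.top]_(i < size p)
    (v (constF (p \Po ('X + a%:P))`_i) + Fin (gamma *+ i)).

(* On quotients this is w p - w q, computed on a representative p / q; it does
   not depend on the latter since w is multiplicative on polynomials. *)
Definition monomial_val (a : L) (gamma : G) (x : ratfun L) : ext G :=
  monomial_poly_val a gamma \n_(repr x)
    + ext_opp (monomial_poly_val a gamma \d_(repr x)).

Definition pair_of_definition (w : ratfun L -> ext G) (a : L) (gamma : G) :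
    Prop :=
  value_group w (fun _ => True) gamma /\ w =1 monomial_val a gamma.

Definition minimal_pair (w : ratfun L -> ext G) (a : L) (gamma : G) : Prop :=
  pair_of_definition w a gamma /\
  forall a' : L, Fin gamma <= v (constF (a - a')) -> degree_le iota a a'.

Definition roots_in (p : {poly L}) : seq L := sval (closed_field_poly_normal p).

(* The empty maximum, for f constant, is -oo. *)
Definition delta (f : {poly K}) : ext G :=
  \big[Order.max/Order.bottom]_(a <- roots_in (map_poly iota f)) v (lin a).

Definition key_polynomial (Q : {poly K}) : Prop :=
  [/\ Q \is monic, (1 < size Q)%N
    & forall f : {poly K}, f != 0 -> (size f < size Q)%N -> delta f < delta Q].

(* The coefficient f_i of the expansion of f in powers of Q, see expansionE. *)
Definition expansion_coef (Q f : {poly K}) (i : nat) : {poly K} :=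
  iter i (fun g => g %/ Q) f %% Q.

Lemma size_expansion_coef (Q f : {poly K}) i :
  Q != 0 -> (size (expansion_coef Q f i) < size Q)%N.
Proof. by move=> Q0; rewrite ltn_modp. Qed.

Lemma expansionE (Q f : {poly K}) :
  (1 < size Q)%N -> f = \sum_(i < size f) expansion_coef Q f i * Q ^+ i.
Proof.
move=> Q1; pose h i := iter i (fun g => g %/ Q) f.
have Q0 : Q != 0 by rewrite -size_poly_gt0 ltnW.
have hsum n : f = \sum_(i < n) expansion_coef Q f i * Q ^+ i + h n * Q ^+ n.
  elim: n => [|n IHn]; first by rewrite big_ord0 add0r mulr1.
  rewrite big_ord_recr /= {1}IHn -addrA; congr (_ + _).
  by rewrite {1}(divp_eq (h n) Q) mulrDl addrC -mulrA -exprS.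
have hsz n : (size (h n) <= size f - n)%N.
  elim: n => [|n IHn]; first by rewrite subn0.
  rewrite /h iterS size_divp // subnS -/(h n) -[X in (_ <= X)%N]subn1.
  by apply: leq_sub => //; case: (size Q) Q1 => [|[]].
have /size_poly_leq0P hf : (size (h (size f)) <= 0)%N by rewrite -(subnn (size f)).
by rewrite {1}(hsum (size f)) hf mul0r addr0.
Qed.

Definition truncation (Q f : {poly K}) : ext G :=
  \big[Order.min/Order.top]_(i < size f)
    (v (polyK (expansion_coef Q f i)) + v (polyK Q) *+ i).

Definition complete_sequence (Lambda : {poly K} -> Prop) : Prop :=
  [/\ forall Q, Lambda Q -> key_polynomial Q,
      forall Q Q', Lambda Q -> Lambda Q' -> Q <> Q' -> delta Q <> delta Q',
      well_ordered Lambda (fun Q Q' => delta Q < delta Q')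
    & forall f, exists2 Q, Lambda Q & v (polyK f) = truncation Q f].

End KeyPolynomials.

(* Main.v *)
Require Import Defs.
From HB Require Import structures.
From mathcomp Require Import all_boot all_order all_algebra.
From mathcomp Require Import boolp classical_sets.

(* Every root b of Q_nu is a conjugate of a_nu, so delta Q_nu = gamma_nu by (iv);
   a root b of a polynomial of smaller degree with v(X - b) >= gamma_nu would
   satisfy v(a_nu - b) >= gamma_nu, against the minimality of (a_nu, gamma_nu).
   Given f, take nu with gamma_nu > delta f and let w be the monomial valuation
   of center a_nu and slope gamma_nu. In the graded ring of w, a polynomial ring
   in the class T of X - a_nu, the factor X - b is a constant when
   v(X - b) < gamma_nu and a polynomial of degree 1 in T when
   v(X - b) = gamma_nu. Hence the initial forms of f and of the coefficients f_i
   of its Q_nu-expansion are constants, whereas that of Q_nu has degree k > 0.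
   The initial forms of the f_i Q_nu^i thus have distinct degrees i k and cannot
   cancel, so that v f = w f = min_i w (f_i Q_nu^i) = min_i v (f_i Q_nu^i). *)

Set Implicit Arguments.
Unset Strict Implicit.
Unset Printing Implicit Defensive.

Import Order.TTheory GRing.Theory.

Local Open Scope ring_scope.

(** * Extension of conjugations to automorphisms *)

Section PartialEmbedding.
Variables (K : fieldType) (L : closedFieldType) (iota : {rmorphism K -> L}).

(* The graphs of the K-algebra morphisms to L from the subalgebras of L; as L is
   algebraic over K these morphisms are injective, so the notion is symmetric
   in the two components (see partial_embedding_swap). *)
Definition partial_embedding (S : set (L * L)) : Prop :=
  [/\ forall c, S (iota c, iota c),
      forall x x' y y', S (x, x') -> S (y, y') -> S (x - y, x' - y'),
      forall x x' y y', S (x, x') -> S (y, y') -> S (x * y, x' * y')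
    & forall y, S (0, y) -> y = 0].

Section Closure.
Variables (S : set (L * L)) (pS : partial_embedding S).

Lemma partial_embedding0 : S (0, 0).
Proof. by have [/(_ 0)] := pS; rewrite rmorph0. Qed.

Lemma partial_embeddingD x x' y y' :
  S (x, x') -> S (y, y') -> S (x + y, x' + y').
Proof.
have [_ SB _ _] := pS; rewrite -{2}[y]opprK -{2}[y']opprK => Sx Sy.
apply: (SB) => //; rewrite -[- y]sub0r -[- y']sub0r.
exact: SB partial_embedding0 Sy.
Qed.

Lemma partial_embedding_inj u y z : S (u, y) -> S (u, z) -> y = z.
Proof.
have [_ SB _ S0] := pS => Sy Sz; apply/eqP; rewrite -subr_eq0; apply/eqP.
by apply: S0; have := SB _ _ _ _ Sy Sz; rewrite subrr.
Qed.

Lemma partial_embedding_horner (g : {poly K}) u w : S (u, w) ->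
  S ((map_poly iota g).[u], (map_poly iota g).[w]).
Proof.
have [SK _ SM _] := pS => Suw; elim/poly_ind: g => [|g c IHg].
  by rewrite rmorph0 !horner0; exact: partial_embedding0.
rewrite rmorphD rmorphM /= map_polyX map_polyC !hornerE.
exact: (partial_embeddingD (SM _ _ _ _ IHg Suw) (SK c)).
Qed.

End Closure.

(** As [u] is nonzero, factors ['X] can be divided out of an annihilating polynomial without losing
    the root [u]. *)
Lemma algebraic_poly_coef0 (u : L) : algebraicOver iota u -> u != 0 ->
  exists g : {poly K}, g`_0 != 0 /\ root (map_poly iota g) u.
Proof.
move=> [g g0 gu] u0; have [n] := ubnP (size g).
elim: n g g0 gu => // n IHn g g0 gu /ltnSE szg.
have [g00|] := eqVneq g`_0 0; last by exists g.
have /factor_theorem[q gq] : root g 0 by rewrite /root horner_coef0 g00.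
rewrite subr0 in gq; have q0 : q != 0 by apply: contraNneq g0 => q0; rewrite gq q0 mul0r.
apply: (IHn q) => //; last by move: szg; rewrite gq size_mulX.
by move: gu; rewrite gq rmorphM /= map_polyX rootM [root 'X u]rootX (negPf u0) orbF.
Qed.

Hypothesis L_algebraic : forall x : L, algebraicOver iota x.

(** For an annihilating polynomial of [u] with constant coefficient c nonzero, evaluation along [S]
    would put (0, iota c) in [S]. *)
Lemma partial_embedding_eq0 S u : partial_embedding S -> S (u, 0) -> u = 0.
Proof.
move=> pS Su; apply/eqP; apply: contraT => /(algebraic_poly_coef0 (L_algebraic u)).
move=> [g [/negPf g0 /eqP gu]]; have [_ _ _ S0] := pS.
have := partial_embedding_horner pS g Su.
by rewrite gu => /S0; rewrite horner_coef0 coef_map => /eqP; rewrite fmorph_eq0 g0.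
Qed.

Definition coefs_in (S : set (L * L)) (p q : {poly L}) :=
  forall i, S (p`_i, q`_i).

Section CoefsIn.
Variables (S : set (L * L)) (pS : partial_embedding S).

Lemma coefs_inC x y : S (x, y) -> coefs_in S x%:P y%:P.
Proof.
move=> Sxy i; rewrite !coefC; case: eqP => // _; exact: (partial_embedding0 pS).
Qed.

Lemma coefs_in_map (g : {poly K}) : coefs_in S (map_poly iota g) (map_poly iota g).
Proof. by move=> i; rewrite !coef_map; have [SK _ _ _] := pS; exact: SK. Qed.

Lemma coefs_inB p p' q q' : coefs_in S p p' -> coefs_in S q q' ->
  coefs_in S (p - q) (p' - q').
Proof.
by move=> Sp Sq i; rewrite !coefB; have [_ SB _ _] := pS; exact: (SB _ _ _ _ (Sp i) (Sq i)).
Qed.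

Lemma coefs_inM p p' q q' : coefs_in S p p' -> coefs_in S q q' ->
  coefs_in S (p * q) (p' * q').
Proof.
move=> Sp Sq i; rewrite !coefM; elim/big_rec2: _ => [|j y x _ Sxy].
  exact: (partial_embedding0 pS).
have [_ _ SM _] := pS; apply: (partial_embeddingD pS) Sxy.
exact: (SM _ _ _ _ (Sp _) (Sq _)).
Qed.

Lemma coefs_inXn n : coefs_in S 'X^n 'X^n.
Proof. by have := coefs_in_map 'X^n; rewrite map_polyXn. Qed.

Lemma coefs_in0 q : coefs_in S 0 q -> q = 0.
Proof.
have [_ _ _ S0] := pS => Sq; apply/polyP => i; rewrite coef0.
by apply: S0; have := Sq i; rewrite coef0.
Qed.

(* y is a root of the transport p' along S of a polynomial p of minimal size over
   the domain of S that vanishes at x. *)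
Lemma partial_embedding_adjoin x : exists y, exists S' : set (L * L),
  [/\ partial_embedding S', (S `<=` S')%classic & S' (x, y)].
Proof.
pose P n := `[< exists p p', [/\ coefs_in S p p', p != 0, root p x & size p = n] >].
have exP : exists n, P n.
  have [g g0 gx] := L_algebraic x; exists (size (map_poly iota g)).
  apply/asboolP; exists (map_poly iota g), (map_poly iota g).
  by split; rewrite ?map_poly_eq0 //; exact: coefs_in_map.
case: (ex_minnP exP) => n /asboolP[p [p' [Sp p0 px szp]]] minp {exP}.
(* [S] is injective, so the transport [p'] keeps the degree of [p] and therefore has a root. *)
have lp' : p'`_n.-1 != 0.
  apply/eqP => p'n; have := Sp n.-1; rewrite p'n => /(partial_embedding_eq0 pS).
  by move/eqP; rewrite -szp lead_coef_eq0 (negPf p0).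
have [|y py] := @closed_rootP L p' _.
  have n_gt1 : (1 < n)%N by rewrite -szp (root_size_gt1 p0 px).
  apply/eqP => szp'; move/eqP: lp'; apply; apply: nth_default.
  by rewrite szp' -ltnS prednK // ltnW.
(* This claim makes f(x) |-> f'(y) well defined. *)
have step f f' : coefs_in S f f' -> root f x -> root f' y.
  have [m] := ubnP (size f); elim: m f f' => // m IHm f f' /ltnSE szf Sf fx.
  have [f0|f0] := eqVneq f 0.
    by move: Sf; rewrite f0 => /coefs_in0 ->; exact: root0.
  have le_pf : (n <= size f)%N by apply: minp; apply/asboolP; exists f, f'.
  pose k := (size f - n)%N.
  (* Cross-multiplication by leading coefficients cancels the top term of [f] without any division
     in the domain of [S]. Since p'(y) = 0, h'(y) is f'(y) times the nonzero leading coefficient of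
     [p']. *)
  pose h := (p`_n.-1)%:P * f - (f`_(size f).-1)%:P * ('X^k * p).
  pose h' := (p'`_n.-1)%:P * f' - (f'`_(size f).-1)%:P * ('X^k * p').
  have Sh : coefs_in S h h'.
    apply: coefs_inB; apply: coefs_inM => //; first exact: coefs_inC.
      exact: coefs_inC.
    exact: coefs_inM (coefs_inXn k) _.
  have szh : (size h < size f)%N.
    have f_gt0 : (0 < size f)%N by rewrite size_poly_gt0.
    rewrite -(prednK f_gt0) ltnS; apply/leq_sizeP => j.
    rewrite leq_eqVlt => /orP[/eqP <-|le_fj].
      rewrite coefB !coefCM coefXnM ifF; last first.
        by apply/negbTE; rewrite -leqNgt /k -subn1 leq_sub2l // -szp size_poly_gt0.
      have -> : ((size f).-1 - k = n.-1)%N.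
        by rewrite /k -!subn1 subnAC subKn.
      by rewrite mulrC subrr.
    have szj : (size f <= j)%N by rewrite -(prednK f_gt0).
    rewrite coefB !coefCM coefXnM [f`_j]nth_default // mulr0 sub0r.
    rewrite ifF; last by apply/negbTE; rewrite -leqNgt (leq_trans (leq_subr _ _) szj).
    rewrite [p`__]nth_default ?mulr0 ?oppr0 // szp /k leq_subRL //.
      by rewrite addnC subnKC.
    exact: leq_trans (leq_subr _ _) szj.
  have := IHm h h' (leq_trans szh szf) Sh.
  rewrite /root !hornerE /= (eqP px) (eqP fx) (eqP py) !mulr0 subrr eqxx subr0.
  by move=> /(_ isT); rewrite mulf_eq0 (negPf lp').
exists y, [set z | exists f f', coefs_in S f f' /\ z = (f.[x], f'.[y])]%classic.
split; first split.
- move=> c; exists (iota c)%:P, (iota c)%:P; rewrite !hornerC; split => //.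
  by apply: coefs_inC; have [SK _ _ _] := pS; exact: SK.
- move=> _ _ _ _ [f [f' [Sf [-> ->]]]] [g [g' [Sg [-> ->]]]]; exists (f - g), (f' - g').
  by rewrite !hornerE; split => //; exact: coefs_inB.
- move=> _ _ _ _ [f [f' [Sf [-> ->]]]] [g [g' [Sg [-> ->]]]]; exists (f * g), (f' * g').
  by rewrite !hornerE; split => //; exact: coefs_inM.
- by move=> y' [f [f' [Sf [fx ->]]]]; apply/eqP/(step f) => //; apply/eqP.
- move=> [u w] Suw; exists u%:P, w%:P; rewrite !hornerC; split => //.
  exact: coefs_inC.
- exists 'X, 'X; rewrite !hornerX; split => //; rewrite -(expr1 'X).
  exact: coefs_inXn.
Qed.

End CoefsIn.

(** * Maximal embeddings are automorphisms *)

Definition maximal_partial_embedding S := partial_embedding S /\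
  forall S', partial_embedding S' -> (S `<=` S')%classic -> (S' `<=` S)%classic.

Lemma maximal_partial_embedding_total S x :
  maximal_partial_embedding S -> exists y, S (x, y).
Proof.
move=> [pS maxS]; have [y [S' [pS' SS' S'xy]]] := partial_embedding_adjoin pS x.
by exists y; exact: (maxS S').
Qed.

Definition swap_rel (S : set (L * L)) : set (L * L) := [set z | S (z.2, z.1)]%classic.

Lemma partial_embedding_swap S : partial_embedding S -> partial_embedding (swap_rel S).
Proof.
move=> pS; have [SK SB SM _] := pS; split=> [c|x x' y y'|x x' y y'|y].
- exact: SK.
- exact: SB.
- exact: SM.
- exact: partial_embedding_eq0.
Qed.

(** Surjectivity of a maximal morphism is totality of its inverse, which follows once the inverse is
    maximal too. *)
Lemma maximal_partial_embedding_swap S :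
  maximal_partial_embedding S -> maximal_partial_embedding (swap_rel S).
Proof.
move=> [pS maxS]; split=> [|S' pS' SS' [x y]]; first exact: partial_embedding_swap.
move=> S'xy; apply: (maxS _ (partial_embedding_swap pS') _ (y, x)) => //.
by move=> [u w] Suw; exact: (SS' (w, u)).
Qed.

Lemma partial_embedding_maximal S : partial_embedding S ->
  exists2 M, maximal_partial_embedding M & (S `<=` M)%classic.
Proof.
(* Zorn's lemma is applied to the sets added to [S], so that the empty chain, whose union is empty,
   is covered as well. *)
move=> pS; pose P := [set T | partial_embedding (S `|` T)]%classic.
have [|M [PM maxM]] := @Zorn_bigcup _ P.
  move=> F FP Ftot.
  have [->|/set0P [T0 FT0]] := eqVneq F set0.
    by rewrite bigcup_set0 /P /= setU0.
  (* Each closure property involves at most two pairs, and these already lie in the union of [S]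
     with a single member of the chain. *)
  have common z1 z2 : (S `|` \bigcup_(T in F) T)%classic z1 ->
      (S `|` \bigcup_(T in F) T)%classic z2 ->
      exists2 T, F T & (S `|` T)%classic z1 /\ (S `|` T)%classic z2.
    move=> [Sz1|[T1 FT1 T1z1]] [Sz2|[T2 FT2 T2z2]].
    - by exists T0 => //; split; left.
    - by exists T2 => //; split; [left|right].
    - by exists T1 => //; split; [right|left].
    - have [T12|T21] := Ftot _ _ FT1 FT2.
        by exists T2 => //; split; right => //; exact: T12.
      by exists T1 => //; split; right => //; exact: T21.
  have incl T : F T -> (S `|` T `<=` S `|` \bigcup_(T in F) T)%classic.
    by move=> FT z [Sz|Tz]; [left|right; exists T].
  rewrite /P /=; split.
  - by move=> c; left; have [SK _ _ _] := pS; exact: SK.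
  - move=> x x' y y' zx zy; have [T FT [Tx Ty]] := common _ _ zx zy.
    by have [_ TB _ _] := FP _ FT; apply: (incl _ FT); exact: TB.
  - move=> x x' y y' zx zy; have [T FT [Tx Ty]] := common _ _ zx zy.
    by have [_ _ TM _] := FP _ FT; apply: (incl _ FT); exact: TM.
  - move=> y zy; have [T FT [Ty _]] := common _ _ zy zy.
    by have [_ _ _ T0'] := FP _ FT; exact: T0'.
exists (S `|` M)%classic; last exact: subsetUl.
split=> // T pT sT z Tz; apply: contrapT => nz.
have ST : (S `|` T = T)%classic by apply/setUidr => u Su; apply: (sT); left.
apply: (maxM T); last by rewrite /P /= ST.
split; first by move=> u Mu; apply: (sT); right.
by move=> TM; apply: (nz); right; exact: TM.
Qed.

(** Totality of [S] and of [swap_rel S] yields two functions by choice. Single-valuedness makes the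
    first a ring morphism and the second its inverse. *)
Lemma maximal_partial_embedding_automorphism S :
  maximal_partial_embedding S ->
  exists s : {rmorphism L -> L},
    [/\ bijective s, forall c, s (iota c) = iota c & forall x, S (x, s x)].
Proof.
move=> maxS; have pS := maxS.1; have [SK SB SM _] := pS.
have [s Ss] := choice (fun x => maximal_partial_embedding_total x maxS).
have [t St] := choice (fun x =>
  maximal_partial_embedding_total x (maximal_partial_embedding_swap maxS)).
have sE x y : S (x, y) -> s x = y := partial_embedding_inj pS (Ss x).
have sB : zmod_morphism s by move=> x y; apply: sE; exact: SB.
have sM : monoid_morphism s.
  by split=> [|x y]; apply: sE; [rewrite -(rmorph1 iota); exact: SK|exact: SM].
pose sA := GRing.isZmodMorphism.Build L L s sB.
pose sR := GRing.isMonoidMorphism.Build L L s sM.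
pose f : {rmorphism L -> L} := HB.pack s sA sR.
exists f; split=> [|c|x]; [|exact: sE|exact: Ss].
exists t => [x|y]; last by apply: sE; exact: St.
exact: (partial_embedding_inj (partial_embedding_swap pS) (St (s x)) (Ss x)).
Qed.

Lemma minimal_poly_dvdp (a : L) (Q f : {poly K}) : minimal_poly iota a Q ->
  root (map_poly iota f) a -> Q %| f.
Proof.
move=> [Qm Qa minQ] fa; rewrite /dvdp; apply: contraT => r0.
have := minQ _ r0; rewrite {1}/root leqNgt ltn_modp monic_neq0 // => /(_ _)/negP[].
  move: fa; rewrite /root {1}(divp_eq f Q) rmorphD rmorphM /= !hornerE.
  by rewrite (eqP Qa) mulr0 add0r.
by [].
Qed.

(** The map f(a) |-> f(b) on K[a] is well defined, as [Q] divides every f with f(a) = 0, and a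
    maximal extension of it is an automorphism of [L]. *)
Lemma minimal_poly_root_conjugate (a b : L) (Q : {poly K}) :
  minimal_poly iota a Q -> root (map_poly iota Q) b -> conjugate iota a b.
Proof.
move=> Qa Qb.
pose S := [set z | exists f : {poly K},
  z = ((map_poly iota f).[a], (map_poly iota f).[b])]%classic.
have pS : partial_embedding S.
  split.
  - by move=> c; exists c%:P; rewrite map_polyC !hornerC.
  - move=> _ _ _ _ [f [-> ->]] [g [-> ->]]; exists (f - g).
    by rewrite rmorphB !hornerE.
  - move=> _ _ _ _ [f [-> ->]] [g [-> ->]]; exists (f * g).
    by rewrite rmorphM !hornerE.
  - move=> y [f [/esym/eqP fa ->]]; apply/eqP.
    have /dvdpP[g ->] := minimal_poly_dvdp Qa fa.
    by rewrite rmorphM /= hornerM (eqP Qb) mulr0.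
have [M maxM SM] := partial_embedding_maximal pS.
have [s [bij_s s_id Ms]] := maximal_partial_embedding_automorphism maxM.
exists s; split=> //; apply: (partial_embedding_inj maxM.1) (Ms a).
by apply: SM; exists 'X; rewrite map_polyX !hornerX.
Qed.

End PartialEmbedding.

(** * Degrees of simple extensions *)

Section Degree.
Variables (K : fieldType) (L : closedFieldType) (iota : {rmorphism K -> L}).

Lemma exists_minimal_poly (b : L) : algebraicOver iota b ->
  exists P, minimal_poly iota b P.
Proof.
move=> [f f0 fb].
pose P n := `[< exists p, [/\ p != 0, root (map_poly iota p) b & size p = n] >].
have exP : exists n, P n by exists (size f); apply/asboolP; exists f.
case: (ex_minnP exP) => n /asboolP[p [p0 pb szp]] minp.
have lp : lead_coef p != 0 by rewrite lead_coef_eq0.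
exists ((lead_coef p)^-1 *: p); split.
- by rewrite monicE lead_coefZ mulVf.
- by rewrite map_polyZ rootZ // fmorph_eq0 invr_eq0.
- move=> q q0 qb; rewrite size_scale ?invr_eq0 // szp.
  by apply: minp; apply/asboolP; exists q.
Qed.

(** The powers of [a] with exponent below the degree of [Q] form a basis: they are independent by
    minimality of [Q], and they generate because a Bezout relation inverts each denominator. *)
Lemma has_dim_simple_ext (a : L) (Q : {poly K}) : minimal_poly iota a Q ->
  has_dim iota (simple_ext iota a) (size Q).-1.
Proof.
move=> Qa; have [Qm Qroot minQ] := Qa.
have Q0 := monic_neq0 Qm.
have szQ : (size Q).-1.+1 = size Q by rewrite prednK // size_poly_gt0.
have sumE (c : nat -> K) : \sum_(i < (size Q).-1) iota (c i) * a ^+ i =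
    (map_poly iota (\poly_(i < (size Q).-1) c i)).[a].
  rewrite poly_def rmorph_sum horner_sum; apply: eq_bigr => i _.
  by rewrite /= map_polyZ map_polyXn !hornerE.
exists (fun i => a ^+ i); split.
- move=> i; exists 'X^i, 1; rewrite map_polyXn rmorph1 !hornerE oner_neq0.
  by rewrite divr1.
(* [insub] extends [c] by 0 to all natural indices. *)
- move=> c c0; pose p := \poly_(i < (size Q).-1) oapp c 0 (insub i).
  have cE (i : 'I_(size Q).-1) : c i = p`_i.
    by rewrite coef_poly ltn_ord valK.
  have pa : root (map_poly iota p) a.
    rewrite /root -sumE -[X in _ == X]c0; apply/eqP/eq_bigr => i _.
    by rewrite valK.
  move=> i; rewrite cE; have [->|p0] := eqVneq p 0; first by rewrite coef0.
  have := leq_trans (minQ p p0 pa) (size_poly _ _).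
  by rewrite -{1}szQ ltnn.
- move=> x [p [q [qa ->]]].
  (* Write Q = h d with d the gcd. If h(a) = 0, minimality of [Q] makes [d] constant; if d(a) = 0,
     then q(a) = 0, which is excluded. *)
  have /Bezout_eq1_coprimepP[[u w] /= uw] : coprimep q Q.
    move: (dvdp_gcdr q Q) (dvdp_gcdl q Q); rewrite /coprimep.
    move: (gcdp q Q) => d /dvdpP[h Qh] /dvdpP[k qk]; have := Qroot.
    rewrite {1}Qh rmorphM rootM => /orP[ha|ga]; last first.
      by case/negP: qa; rewrite qk rmorphM hornerM (eqP ga) mulr0.
    have h0 : h != 0 by apply: contraNneq Q0 => h0; rewrite Qh h0 mul0r.
    have d0 : d != 0 by apply: contraNneq Q0 => d0; rewrite Qh d0 mulr0.
    have := minQ h h0 ha; rewrite Qh size_mul //.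
    rewrite -[size d]prednK ?size_poly_gt0 // addnS /=.
    by rewrite -[X in (_ <= X)%N]addn0 leq_add2l leqn0.
  have uq : (map_poly iota u).[a] * (map_poly iota q).[a] = 1.
    rewrite -hornerM -rmorphM.
    have := congr1 (fun f => (map_poly iota f).[a]) uw.
    by rewrite rmorph1 hornerC rmorphD !rmorphM /= !hornerE (eqP Qroot) mulr0 addr0.
  have -> : (map_poly iota p).[a] / (map_poly iota q).[a] =
      (map_poly iota ((p * u) %% Q)).[a].
    have -> : (map_poly iota q).[a]^-1 = (map_poly iota u).[a].
      by rewrite -[LHS]mul1r -uq mulfK.
    rewrite -hornerM -rmorphM {1}(divp_eq (p * u) Q) rmorphD !rmorphM /=.
    by rewrite !hornerE (eqP Qroot) mulr0 add0r.
  set r := _ %% Q; exists (fun i => r`_i); rewrite (sumE (fun i => r`_i)).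
  congr (_.[a]); congr (map_poly iota _); apply/polyP => i.
  rewrite coef_poly; case: ltnP => // le_i; apply/leq_sizeP: i le_i.
  by rewrite -ltnS szQ ltn_modp.
Qed.

(** This turns the comparison of dimensions in [minimal_pair] into one of degrees of polynomials. *)
Lemma minimal_poly_degree_le (a b : L) (Q f : {poly K}) :
  minimal_poly iota a Q -> degree_le iota a b ->
  f != 0 -> root (map_poly iota f) b -> (size Q <= size f)%N.
Proof.
move=> Qa ab f0 fb.
have [P Pb] := @exists_minimal_poly b (ex_intro2 _ _ f f0 fb).
have := ab _ _ (has_dim_simple_ext Qa) (has_dim_simple_ext Pb).
have [[/monic_neq0 Q0 _ _] [/monic_neq0 P0 _ minP]] := (Qa, Pb).
rewrite -ltnS !prednK ?size_poly_gt0 // => /leq_trans; apply.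
exact: minP.
Qed.

End Degree.

(** * Initial degrees *)

Section ExtOrder.
Variable G : oagType.

Lemma oag_ltrD2l (z x y : G) : x < y -> z + x < z + y.
Proof.
rewrite !lt_def => /andP[yx xy]; rewrite (oag_lerD2l z xy) andbT.
by apply: contra_neq yx => /addrI.
Qed.

Lemma ext_leD (x y z w : ext G) : x <= y -> z <= w -> x + z <= y + w.
Proof.
move: x y z w => [|x|] [|y|] [|z|] [|w|] //=.
change (x <= y -> z <= w -> x + z <= y + w :> G) => xy zw.
by apply: le_trans (oag_lerD2l x zw) _; rewrite ![_ + w]addrC; exact: oag_lerD2l.
Qed.

(** The lower bounds are finite because an infinite summand would absorb the strict inequality. *)
Lemma ext_le_ltD (x z : G) (y w : ext G) :
  Fin x <= y -> Fin z < w -> Fin x + Fin z < y + w.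
Proof.
move: y w => [|y|] [|w|] //=.
change (x <= y -> (Fin z : ext G) < Fin w -> (Fin (x + z) : ext G) < Fin (y + w)).
rewrite !ext_lt_Fin => xy zw.
apply: lt_le_trans (oag_ltrD2l x zw) _.
by rewrite ![_ + w]addrC; exact: oag_lerD2l.
Qed.

Lemma ext_ltD2r (h : G) (x y : ext G) : x + Fin h < y + Fin h -> x < y.
Proof. by rewrite !ltNge; apply: contra => yx; exact: ext_leD. Qed.

Lemma Fin_mulrn (x : G) n : Fin x *+ n = Fin (x *+ n) :> ext G.
Proof. by elim: n => // n IHn; rewrite !mulrS IHn. Qed.

End ExtOrder.

(** * Ultrametric estimates for sums *)

Section Valuation.
Variables (F : fieldType) (G : oagType) (v : valuation F G).

Lemma val_ge_add (m : ext G) (x y : F) : m <= v x -> m <= v y -> m <= v (x + y).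
Proof. by move=> mx my; apply: le_trans (val_add v x y); rewrite le_min mx. Qed.

Lemma val_gt_add (m : ext G) (x y : F) : m < v x -> m < v y -> m < v (x + y).
Proof. by move=> mx my; apply: lt_le_trans (val_add v x y); rewrite lt_min mx. Qed.

Lemma val_add_lt (x y : F) : v x < v y -> v (x + y) = v x.
Proof.
move=> xy; apply/le_anti; rewrite (val_ge_add (lexx _) (ltW xy)) andbT leNgt.
apply/negP => xxy; have := val_gt_add xxy (_ : v x < v (- y)).
by rewrite valN xy addrK ltxx => /(_ isT).
Qed.

Lemma val_PInf (x : F) : v x = PInf -> x = 0.
Proof. by move=> vx; apply/eqP; apply: contraT => /(val_fin v)[g]; rewrite vx. Qed.

Lemma val_exp (x : F) n : v (x ^+ n) = v x *+ n.
Proof.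
elim: n => [|n IHn]; first by rewrite expr0 Defs.val1.
by rewrite exprS mulrS val_mul IHn.
Qed.

(** The shift [Fin h] will be the weight [g *+ j] of a Taylor coefficient, so that these estimates
    apply directly to [taylor_val]. *)
Lemma val_sum_ge (h : G) (m : ext G) (I : Type) (r : seq I) (P : pred I)
    (E : I -> F) :
  (forall i, P i -> m <= v (E i) + Fin h) ->
  m <= v (\sum_(i <- r | P i) E i) + Fin h.
Proof.
move=> mE; elim/big_rec: _ => [|i x Pi mx]; first by rewrite val_zero; case: (m).
apply: le_trans (ext_leD (val_add v _ _) (lexx _)).
by rewrite /Order.min; case: ifP => _; [exact: mE|].
Qed.

Lemma val_sum_gt (h m : G) (I : Type) (r : seq I) (P : pred I)
    (E : I -> F) :
  (forall i, P i -> Fin m < v (E i) + Fin h) ->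
  Fin m < v (\sum_(i <- r | P i) E i) + Fin h.
Proof.
move=> mE; elim/big_rec: _ => [|i x Pi mx]; first by rewrite val_zero.
apply: lt_le_trans (ext_leD (val_add v _ _) (lexx _)).
by rewrite /Order.min; case: ifP => _; [exact: mE|].
Qed.

Lemma val_sum_eq (h m : G) (I : finType) (i0 : I) (E : I -> F) :
  v (E i0) + Fin h = Fin m ->
  (forall i, i != i0 -> Fin m < v (E i) + Fin h) ->
  v (\sum_i E i) + Fin h = Fin m.
Proof.
move=> i0m im; rewrite (bigD1 i0) //= val_add_lt //.
by apply: (@ext_ltD2r _ h); rewrite i0m; exact: val_sum_gt.
Qed.

End Valuation.

(** * Initial forms of products *)

Section InitialDegree.
Variables (L : closedFieldType) (G : oagType) (v : valuation (ratfun L) G).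
Variables (a : L) (g : G).

(* With w the monomial valuation of center a and slope g, has_initial_degree p N m
   says that w p = m and that the initial form of p in the graded ring of w, a
   polynomial in the class of X - a, has degree N. *)
Definition taylor_val (p : {poly L}) (j : nat) : ext G :=
  v (constF (p \Po ('X + a%:P))`_j) + Fin (g *+ j).

Definition has_initial_degree (p : {poly L}) (N : nat) (m : G) : Prop :=
  [/\ forall j, Fin m <= taylor_val p j,
      taylor_val p N = Fin m
    & forall j, (N < j)%N -> Fin m < taylor_val p j].

Lemma taylor_val0 j : taylor_val 0 j = PInf.
Proof. by rewrite /taylor_val comp_poly0 coef0 /constF polyC0 rmorph0 val_zero. Qed.

Lemma constF_sum (I : Type) (r : seq I) (P : pred I) (F : I -> L) :
  constF (\sum_(i <- r | P i) F i) = \sum_(i <- r | P i) constF (F i).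
Proof. by rewrite /constF !rmorph_sum. Qed.

Lemma taylor_val_mulE (p q : {poly L}) n :
  let F (i : 'I_n.+1) := constF ((p \Po ('X + a%:P))`_i)
    * constF ((q \Po ('X + a%:P))`_(n - i)) in
  taylor_val (p * q) n = v (\sum_i F i) + Fin (g *+ n) /\
  forall i : 'I_n.+1,
    v (F i) + Fin (g *+ n) = taylor_val p i + taylor_val q (n - i).
Proof.
move=> F; split.
  rewrite /taylor_val comp_polyM coefM constF_sum; congr (v _ + _).
  by apply: eq_bigr => i _; rewrite /F /constF !rmorphM.
move=> i; rewrite val_mul /taylor_val addrACA; congr (_ + _).
by rewrite -{1}(subnKC (ltn_ord i : (i <= n)%N)) mulrnDr.
Qed.

(** As in Gauss's lemma: in the Cauchy sum at index N + M, every pair of indices other than (N, M)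
    has a component beyond [N] or [M], hence a larger value. Beyond N + M this is true of every
    pair. *)
Lemma has_initial_degreeM (p q : {poly L}) N M m l :
  has_initial_degree p N m -> has_initial_degree q M l ->
  has_initial_degree (p * q) (N + M) (m + l).
Proof.
move=> [pge pN pgt] [qge qM qgt].
have strict i j : (N < i)%N || (M < j)%N ->
    Fin (m + l) < taylor_val p i + taylor_val q j.
  case/orP=> [Ni|Mj]; last exact: ext_le_ltD (pge i) (qgt j Mj).
  rewrite [taylor_val p i + _]addrC [m + l]addrC.
  exact: (ext_le_ltD (qge j) (pgt i Ni)).
split.
- move=> n; have [-> FE] := taylor_val_mulE p q n.
  apply: val_sum_ge => i _; rewrite FE.
  exact: (ext_leD (pge i) (qge _)).
- have [-> FE] := taylor_val_mulE p q (N + M).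
  have NM : (N < (N + M).+1)%N by rewrite ltnS leq_addr.
  apply: (@val_sum_eq _ _ _ _ _ _ (Ordinal NM)).
    by rewrite FE /= addKn pN qM.
  move=> i iN; rewrite FE; apply: strict.
  have : (i != N :> nat) by [].
  rewrite neq_ltn => /orP[iN'|->//]; apply/orP; right.
  by rewrite ltn_subRL ltn_add2r.
- move=> n NMn; have [-> FE] := taylor_val_mulE p q n.
  apply: val_sum_gt => i _; rewrite FE; apply: strict.
  case: ltnP => //= iN; rewrite ltn_subRL.
  by apply: leq_ltn_trans NMn; rewrite leq_add2r.
Qed.

Lemma has_initial_degreeC (c : L) m : v (constF c) = Fin m ->
  has_initial_degree c%:P 0 m.
Proof.
move=> cm; rewrite /has_initial_degree /taylor_val comp_polyC.
have coefS j : v (constF (c%:P)`_j.+1) + Fin (g *+ j.+1) = PInf.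
  by rewrite coefC /constF polyC0 rmorph0 val_zero.
split; last by case=> // j _; rewrite coefS.
  by case=> [|j]; rewrite ?coefS // coefC /= cm mulr0n addr0.
by rewrite coefC /= cm mulr0n addr0.
Qed.

Lemma has_initial_degree_exp (p : {poly L}) N m i :
  has_initial_degree p N m -> has_initial_degree (p ^+ i) (i * N) (m *+ i).
Proof.
move=> pN; elim: i => [|i IHi].
  by rewrite expr0 -polyC1; apply: has_initial_degreeC; rewrite /constF !rmorph1 Defs.val1.
by rewrite exprS mulSn mulrS; exact: has_initial_degreeM.
Qed.

Lemma constF_lin_sub (b c : L) : constF (c - b) = lin b - lin c.
Proof.
rewrite /lin -rmorphB /constF polyCB; congr FracField.tofrac.
by rewrite opprB [RHS]addrC addrA subrK.
Qed.

Hypothesis a_val : v (lin a) = Fin g.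

(** Write X - b = (X - a) + (a - b). If v(X - b) < g, then v(a - b) = v(X - b) and the constant term
    dominates; if v(X - b) = g, then v(a - b) >= g and the linear term attains the minimum. The
    boolean is read as the degree 0 or 1. *)
Lemma has_initial_degree_lin (b : L) : v (lin b) <= Fin g ->
  exists2 m, v (lin b) = Fin m &
    has_initial_degree ('X - b%:P) (v (lin b) == Fin g) m.
Proof.
move=> bg; have /(val_fin v)[m vm] : lin b != 0.
  by rewrite /lin tofrac_eq0 polyXsubC_eq0.
exists m => //; move: bg; rewrite vm => bg.
have compE : ('X - b%:P) \Po ('X + a%:P) = 'X + (a - b)%:P.
  by rewrite comp_polyB comp_polyX comp_polyC polyCB addrA.
rewrite /has_initial_degree /taylor_val compE.
have coef0E : v (constF ('X + (a - b)%:P)`_0) + Fin (g *+ 0) = v (constF (a - b)).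
  by rewrite coefD coefX coefC add0r mulr0n addr0.
have coef1E : v (constF ('X + (a - b)%:P)`_1) + Fin (g *+ 1) = Fin g.
  by rewrite coefD coefX coefC addr0 /constF !rmorph1 Defs.val1 mulr1n add0r.
have coef2E j : v (constF ('X + (a - b)%:P)`_j.+2) + Fin (g *+ j.+2) = PInf.
  by rewrite coefD coefX coefC addr0 /constF polyC0 rmorph0 val_zero.
have ab : Fin m <= v (constF (a - b)).
  by rewrite constF_lin_sub val_ge_add // ?valN ?vm ?a_val.
have [[mg]|mg] := eqVneq (Fin m : ext G) (Fin g).
  split=> [[|[|j]]||[|[|j]]] //; rewrite ?coef0E ?coef1E ?coef2E ?mg //.
  by rewrite -mg.
have mg' : (Fin m : ext G) < Fin g by rewrite lt_neqAle mg bg.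
have ab' : v (constF (a - b)) = Fin m.
  by rewrite constF_lin_sub val_add_lt ?vm // valN a_val.
by split=> [[|[|j]]||[|[|j]]] //; rewrite ?coef0E ?coef1E ?coef2E ?ab'.
Qed.

Lemma mem_roots_in (p : {poly L}) b : p != 0 -> (b \in roots_in p) = root p b.
Proof.
move=> p0; rewrite /roots_in; case: closed_field_poly_normal => r /= pE.
by rewrite [in RHS]pE rootZ ?lead_coef_eq0 // root_prod_XsubC.
Qed.

(** Both conclusions share the same [m]: [v] agrees with the monomial valuation on each linear
    factor, hence on their product. Roots are counted with multiplicity. *)
Lemma has_initial_degree_roots (p : {poly L}) : p != 0 ->
  (forall b, root p b -> v (lin b) <= Fin g) ->
  exists2 m, v (FracField.tofrac p) = Fin m &
    has_initial_degree p (count (fun b => v (lin b) == Fin g) (roots_in p)) m.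
Proof.
move=> p0 pg; have {}pg b : b \in roots_in p -> v (lin b) <= Fin g.
  by rewrite mem_roots_in //; exact: pg.
have pE : p = lead_coef p *: \prod_(z <- roots_in p) ('X - z%:P).
  by rewrite /roots_in; case: closed_field_poly_normal.
have /(val_fin v)[c vc] : constF (lead_coef p) != 0.
  by rewrite /constF tofrac_eq0 polyC_eq0 lead_coef_eq0.
suff [m vm pm] : exists2 m,
    v (FracField.tofrac (\prod_(z <- roots_in p) ('X - z%:P))) = Fin m &
    has_initial_degree (\prod_(z <- roots_in p) ('X - z%:P))
     (count (fun b => v (lin b) == Fin g) (roots_in p)) m.
  exists (c + m).
    by rewrite pE -mul_polyC rmorphM val_mul -/(constF _) vc vm.
  rewrite {1}pE -mul_polyC -[count _ _]add0n.
  exact: has_initial_degreeM (has_initial_degreeC vc) pm.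
elim: (roots_in p) pg => [|b r IHr] bg.
  exists 0; first by rewrite big_nil rmorph1 Defs.val1.
  rewrite big_nil /= -polyC1; apply: has_initial_degreeC.
  by rewrite /constF !rmorph1 Defs.val1.
have [|m vm rm] := IHr; first by move=> c' rc; apply: bg; rewrite in_cons rc orbT.
have [|l vl bl] := @has_initial_degree_lin b; first by apply: bg; exact: mem_head.
exists (l + m); rewrite big_cons; first by rewrite rmorphM val_mul -/(lin b) vl vm.
exact: has_initial_degreeM.
Qed.

End InitialDegree.

(** * Truncations and key polynomials *)

Section Truncation.
Variables (K : fieldType) (L : closedFieldType) (iota : {rmorphism K -> L}).
Variables (G : oagType) (v : valuation (ratfun L) G).

Lemma polyK_eq0 (f : {poly K}) : (polyK iota f == 0) = (f == 0).
Proof. by rewrite /polyK tofrac_eq0 map_poly_eq0. Qed.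

Lemma polyK_sum (I : Type) (r : seq I) (P : pred I) (F : I -> {poly K}) :
  polyK iota (\sum_(i <- r | P i) F i) = \sum_(i <- r | P i) polyK iota (F i).
Proof. by rewrite /polyK !rmorph_sum. Qed.

Lemma val_expansion_term (Q f : {poly K}) i :
  v (polyK iota (expansion_coef Q f i * Q ^+ i)) =
    v (polyK iota (expansion_coef Q f i)) + v (polyK iota Q) *+ i.
Proof. by rewrite /polyK !rmorphM !rmorphXn val_mul val_exp. Qed.

Variables (a : L) (g : G).
Hypothesis a_val : v (lin a) = Fin g.

(** The condition on the roots of [f] is guarded by [f != 0] since everything is a root of 0. *)
Lemma val_truncation (Q f : {poly K}) :
  (1 < size Q)%N -> root (map_poly iota Q) a ->
  (forall b, root (map_poly iota Q) b -> v (lin b) <= Fin g) ->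
  (forall (h : {poly K}) b, h != 0 -> (size h < size Q)%N -> root (map_poly iota h) b ->
     v (lin b) < Fin g) ->
  (forall b, f != 0 -> root (map_poly iota f) b -> v (lin b) < Fin g) ->
  v (polyK iota f) = truncation iota v Q f.
Proof.
move=> Q1 Qa Qg small_g fg.
have Q0 : Q != 0 by rewrite -size_poly_gt0 ltnW.
pose t i := expansion_coef Q f i * Q ^+ i.
have fE : f = \sum_(i < size f) t i := expansionE f Q1.
have truncE : truncation iota v Q f =
    \big[Order.min/Order.top]_(i < size f) v (polyK iota (t i)).
  by apply: eq_bigr => i _; rewrite val_expansion_term.
have [f0|f0] := eqVneq f 0.
  by rewrite truncE f0 size_poly0 big_ord0 /polyK !rmorph0 val_zero.
(* That the truncation is at most v f is the ultrametric inequality; the converse rests on the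
   initial degrees. *)
apply/le_anti/andP; split; last first.
  have mt (i : 'I_(size f)) : truncation iota v Q f <= v (polyK iota (t i)).
    by rewrite truncE; exact: bigmin_inf.
  rewrite {2}fE polyK_sum; move: (truncation _ _ _ _) mt => m mt.
  by elim/big_ind: _ => [|x y|i _]; [rewrite val_zero lex1|exact: val_ge_add|].
have szf : (0 < size f)%N by rewrite size_poly_gt0.
have init0 (h : {poly K}) : h != 0 ->
    (forall b, root (map_poly iota h) b -> v (lin b) < Fin g) ->
    exists2 m, v (polyK iota h) = Fin m &
      has_initial_degree v a g (map_poly iota h) 0 m.
  move=> h0 hg; have [||m vm] := @has_initial_degree_roots _ _ v a g a_val (map_poly iota h).
  - by rewrite map_poly_eq0.
  - by move=> b /hg /ltW.
  rewrite (_ : count _ _ = 0)%N => [?|]; first by exists m.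
  apply/eqP; rewrite -leqn0 leqNgt -has_count; apply/hasPn => b.
  by rewrite mem_roots_in ?map_poly_eq0 // => /hg; rewrite lt_neqAle => /andP[].
have [||mQ vQ] := @has_initial_degree_roots _ _ v a g a_val (map_poly iota Q).
- by rewrite map_poly_eq0.
- exact: Qg.
set k := count _ _ => Qk.
(* The root [a] of [Q] has value exactly [g] and is thus counted. Positivity of [k] keeps the
   degrees i k distinct. *)
have k_gt0 : (0 < k)%N.
  rewrite -has_count; apply/hasP; exists a; last by rewrite a_val.
  by rewrite mem_roots_in ?map_poly_eq0.
have t_init i : t i != 0 -> exists2 m, v (polyK iota (t i)) = Fin m &
    has_initial_degree v a g (map_poly iota (t i)) (i * k) m.
  move=> ti0; have c0 : expansion_coef Q f i != 0.
    by apply: contraNneq ti0 => c0; rewrite /t c0 mul0r.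
  have [b cb|m vm cm] := init0 _ c0.
    exact: small_g c0 (size_expansion_coef f i Q0) cb.
  exists (m + mQ *+ i).
    by rewrite /t val_expansion_term vm [polyK iota Q]/(polyK iota Q) /polyK vQ Fin_mulrn.
  rewrite /t rmorphM rmorphXn -[(i * k)%N]add0n.
  exact: has_initial_degreeM cm (has_initial_degree_exp i Qk).
have [i1 _ i1min] := @arg_minP _ _ _ (Ordinal szf) xpredT
  (fun i : 'I_(size f) => v (polyK iota (t i))) isT.
pose P (i : 'I_(size f)) := v (polyK iota (t i)) == v (polyK iota (t i1)).
have Pi1 : P i1 by exact: eqxx.
(* Among the terms of minimal value take the one of largest index: its initial
   form has larger degree than those of the other minimal terms, and so survives
   in the sum. *)
case: (arg_maxnP (fun i : 'I_(size f) => i : nat) Pi1) => i /eqP Pi imax.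
(* If a term of minimal value were 0, all terms would have value [PInf] and [f] would vanish. *)
have ti0 : t i != 0.
  apply/eqP => ti0; move/eqP: f0; apply; rewrite fE big1 // => j _.
  apply/eqP; rewrite -polyK_eq0; apply/eqP/(@val_PInf _ _ v)/le_anti.
  rewrite lex1 /=; have := i1min j isT.
  by rewrite -Pi ti0 /polyK !rmorph0 val_zero.
have [m vm [_ tim _]] := t_init i ti0.
(* At index i k, a term with j < i is beyond its initial degree j k, while a term with j > i has
   value larger than [m] by the choice of [i]. *)
have fm : taylor_val v a g (map_poly iota f) (i * k) = Fin m.
  rewrite /taylor_val {1}fE rmorph_sum raddf_sum /= coef_sum constF_sum.
  apply: (@val_sum_eq _ _ _ _ _ _ i) => // j ji.
  have [tj0|tj0] := eqVneq (t j) 0.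
    by rewrite tj0 rmorph0 -/(taylor_val _ _ _ _ _) taylor_val0.
  have [l vl [tjge _ tjgt]] := t_init j tj0.
  have ml : (Fin m : ext G) <= Fin l by rewrite -vm -vl Pi; exact: i1min.
  have : (j != i :> nat) by [].
  rewrite neq_ltn => /orP[ltji|ltij].
    by apply: le_lt_trans ml (tjgt _ _); rewrite ltn_pmul2r.
  apply: lt_le_trans (tjge _); rewrite lt_neqAle ml andbT.
  apply: contraTneq ltij => mE; rewrite -leqNgt; apply: imax.
  by rewrite /P vl -mE -vm Pi.
(* The value [l] of [f] bounds all its Taylor values from below, in particular the one at i k, which
   is the minimum of the values of the terms. *)
have [b|l vl [fge _ _]] := init0 f f0; first exact: fg.
rewrite vl truncE; apply: le_trans (fge (i * k)%N) _; rewrite fm -vm Pi.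
by apply: le_bigmin => [|j _]; [exact: lex1|exact: i1min].
Qed.

End Truncation.

(** * Bounds on [delta] through roots *)

Section Delta.
Variables (K : fieldType) (L : closedFieldType) (iota : {rmorphism K -> L}).
Variables (G : oagType) (v : valuation (ratfun L) G).

(** Constants are included: the empty maximum [NInf] is below every finite value. *)
Lemma delta_ltP (f : {poly K}) (g : G) : f != 0 ->
  delta iota v f < Fin g <->
  (forall b, root (map_poly iota f) b -> v (lin b) < Fin g).
Proof.
move=> f0; rewrite /delta; split=> [dg b|bg].
  rewrite -mem_roots_in ?map_poly_eq0 // => bf; apply: le_lt_trans dg.
  exact: (le_bigmax_seq _ b xpredT (fun b => v (lin b))).
rewrite big_seq_cond; apply: bigmax_lt => // b; rewrite andbT.
by rewrite mem_roots_in ?map_poly_eq0 //; exact: bg.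
Qed.

Lemma delta_root_max (f : {poly K}) (a : L) : f != 0 ->
  root (map_poly iota f) a ->
  (forall b, root (map_poly iota f) b -> v (lin b) <= v (lin a)) ->
  delta iota v f = v (lin a).
Proof.
move=> f0 fa amax; apply/le_anti/andP; split.
  rewrite /delta big_seq_cond; apply: bigmax_le => [|b]; first exact: le0x.
  by rewrite andbT mem_roots_in ?map_poly_eq0 //; exact: amax.
apply: (le_bigmax_seq _ a xpredT (fun b => v (lin b))) => //.
by rewrite mem_roots_in ?map_poly_eq0.
Qed.

End Delta.

(** * The sequence of minimal polynomials *)

Theorem theorem7p4
  (K : fieldType) (L : closedFieldType) (iota : {rmorphism K -> L})
  (L_algebraic : forall x : L, algebraicOver iota x)
  (G : oagType) (v : valuation (ratfun L) G)
  (v_algebraic : valuation_algebraic iota v)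
  (d : Order.disp_t) (I : orderType d) (I_limit : limit_ordinal I)
  (gamma : I -> G) (a : I -> L)
  (gamma_val : forall nu, exists b : L, v (lin b) = Fin (gamma nu))
  (gamma_lt : forall nu mu : I, (nu < mu)%O -> gamma nu < gamma mu)
  (gamma_cofinal : forall b : L, exists nu, v (lin b) <= Fin (gamma nu))
  (a_val : forall nu, v (lin (a nu)) = Fin (gamma nu))
  (a_minimal : forall nu,
     minimal_pair iota v (monomial_val v (a nu) (gamma nu)) (a nu) (gamma nu))
  (a_conj : forall nu b, conjugate iota (a nu) b ->
     v (lin b) <= v (lin (a nu)))
  (Q : I -> {poly K})
  (Q_minimal : forall nu, minimal_poly iota (a nu) (Q nu)) :
  complete_sequence iota v (fun P => exists nu, P = Q nu).
Proof.
have Q0 nu : Q nu != 0 by have [/monic_neq0] := Q_minimal nu.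
have Qa nu : root (map_poly iota (Q nu)) (a nu) by have [] := Q_minimal nu.
have Q1 nu : (1 < size (Q nu))%N.
  by rewrite -(size_map_poly iota); apply: root_size_gt1 (Qa nu); rewrite map_poly_eq0.
have Qmax nu b : root (map_poly iota (Q nu)) b -> v (lin b) <= v (lin (a nu)).
  move=> Qb; apply: a_conj.
  exact: minimal_poly_root_conjugate L_algebraic _ _ _ (Q_minimal nu) Qb.
have deltaQ nu : delta iota v (Q nu) = Fin (gamma nu).
  by rewrite -a_val; apply: delta_root_max; [exact: Q0|exact: Qa|exact: Qmax].
have small nu (h : {poly K}) b : h != 0 -> (size h < size (Q nu))%N ->
    root (map_poly iota h) b -> v (lin b) < Fin (gamma nu).
  move=> h0 szh hb; rewrite ltNge; apply: contraTN szh => bge; rewrite -leqNgt.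
  apply: minimal_poly_degree_le (Q_minimal nu) _ h0 hb.
  apply: (a_minimal nu).2.
  by rewrite constF_lin_sub val_ge_add // valN a_val.
have gamma_le nu mu : (nu <= mu)%O -> gamma nu <= gamma mu.
  by rewrite le_eqVlt => /orP[/eqP -> //|/gamma_lt/ltW].
have [[_ _ _ I_wf] [i0] I_succ] := I_limit.
split.
- move=> _ [nu ->]; split=> //; first by have [] := Q_minimal nu.
  move=> h h0 szh; rewrite deltaQ; apply/delta_ltP => // b.
  exact: small.
- move=> _ _ [nu ->] [mu ->] neqQ; rewrite !deltaQ => -[eqg]; apply: neqQ.
  by have [/gamma_lt|/gamma_lt|->//] := ltgtP nu mu; rewrite eqg ltxx.
- split.
  + by move=> P _; rewrite ltxx.
  + by move=> P P' P'' _ _ _; exact: lt_trans.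
  + move=> _ _ [nu ->] [mu ->]; rewrite !deltaQ !ext_lt_Fin.
    have [/gamma_lt|/gamma_lt|->] := ltgtP nu mu; first by constructor 1.
      by constructor 3.
    by constructor 2.
  (* A least element is found among the indices, since [delta (Q nu)] increases strictly with
     [nu]. *)
  + move=> S SQ [P SP]; have [nu PE] := SQ P SP.
    have [||m Sm minm] := I_wf (fun nu => S (Q nu)) => //.
      by exists nu; rewrite -PE.
    exists (Q m) => // P' SP'; have [mu P'E] := SQ P' SP'; rewrite P'E => neq.
    rewrite !deltaQ ext_lt_Fin; apply/gamma_lt/minm; first by rewrite -P'E.
    by move=> mum; apply: neq; rewrite mum.
- move=> f.
  have [nu fnu] : exists nu, forall b, b \in roots_in (map_poly iota f) ->
      v (lin b) < Fin (gamma nu).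
    elim: (roots_in _) => [|b r [nu rnu]]; first by exists i0.
    (* Cofinality gives only a weak bound; an index beyond both [nu] and [mu], which exists at a
       limit ordinal, makes it strict. *)
    have [mu bmu] := gamma_cofinal b; have [xi maxxi] := I_succ (Order.max nu mu).
    have [nuxi muxi] : (nu < xi)%O /\ (mu < xi)%O.
      by move: maxxi; rewrite gt_max => /andP[].
    exists xi => c; rewrite in_cons => /orP[/eqP ->|/rnu cnu].
      by apply: le_lt_trans bmu _; rewrite ext_lt_Fin; exact: gamma_lt.
    by apply: lt_trans cnu _; rewrite ext_lt_Fin; exact: gamma_lt.
  exists (Q nu); first by exists nu.
  apply: (val_truncation (a_val nu)) => //.
  + by move=> b Qb; rewrite -a_val; exact: Qmax.
  + exact: small.
  + by move=> b f0 fb; apply: fnu; rewrite mem_roots_in ?map_poly_eq0.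
Qed.
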